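(* Let $\Lambda_{TU}=\{(F(x),\Lambda_x,v(x))\}_{x\in X}$ be a continuous $(T,U)$-controlled $g$-fusion frame for $H$ with bounds $A,B$, and let $\Gamma_{TU}=\{(G(x),\Gamma_x,v(x))\}_{x\in X}$. Suppose there exist constants $\lambda_1,\lambda_2,\eta$ with $$0\le\lambda_1,\lambda_2<1,\qquad A(1-\lambda_1)-\eta\int_X v^2(x)\,d\mu_x>0,$$ such that for each $f\in H$ (and $x\in X$) $$0\le\langle T^*(P_{G(x)}\Gamma_x^*\Gamma_xP_{G(x)}-P_{F(x)}\Lambda_x^*\Lambda_xP_{F(x)})Uf,f\rangle$$ $$\le\lambda_1\langle T^*P_{F(x)}\Lambda_x^*\Lambda_xP_{F(x)}Uf,f\rangle+\lambda_2\langle T^*P_{G(x)}\Gamma_x^*\Gamma_xP_{G(x)}Uf,f\rangle+\eta\|f\|^2 .$$ Then $\Gamma_{TU}$ is a continuous $(T,U)$-controlled $g$-fusion frame for $H$.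
   Context: $H$ is a separable Hilbert space, $\mathbb H$ is the collection of all closed subspaces of $H$, and $(X,\mu)$ is a measure space with positive measure $\mu$; $d\mu_x$ denotes integration with respect to $\mu$ in the variable $x$. $P_M$ is the orthogonal projection of $H$ onto a closed subspace $M$ (when followed by an operator defined on $M$ it is regarded as a map $H\to M$; its adjoint is then the inclusion $M\to H$). An operator is positive if it is self-adjoint and $\langle Sf,f\rangle\ge 0$ for all $f$; $\mathcal{GB}^+(H)$ is the set of positive bounded operators on $H$ with bounded inverse. Here $T,U\in\mathcal{GB}^+(H)$; $F,G:X\to\mathbb H$ are weakly measurable (for each $f\in H$, $x\mapsto P_{F(x)}f$ and $x\mapsto P_{G(x)}f$ are measurable); $v:X\to\mathbb R^+$ is measurable; $\{K_x\}_{x\in X}$ are Hilbert spaces; and $\Lambda_x:F(x)\to K_x$, $\Gamma_x:G(x)\to K_x$ are bounded linear for each $x\in X$. $\Lambda_{TU}$ is a continuous $(T,U)$-controlled $g$-fusion frame for $H$ with bounds $A,B$ ($0<A\le B<\infty$) if for all $f\in H$ $$A\|f\|^2\le\int_X v^2(x)\langle\Lambda_xP_{F(x)}Uf,\Lambda_xP_{F(x)}Tf\rangle\,d\mu_x\le B\|f\|^2 ;$$ $\Gamma_{TU}$ is a continuous $(T,U)$-controlled $g$-fusion frame for $H$ if the analogous inequalities hold for some positive finite constants with $G,\Gamma_x$ in place of $F,\Lambda_x$. The integrands occurring here are understood to be measurable. *)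

(* Defs.v *)
From HB Require Import structures.
From mathcomp Require Import all_boot all_order all_algebra complex.
From mathcomp Require Import all_classical all_reals all_analysis.

Set Implicit Arguments.
Unset Strict Implicit.
Unset Printing Implicit Defensive.

Import Order.TTheory GRing.Theory Num.Theory.
Import numFieldNormedType.Exports.

Local Open Scope classical_set_scope.
Local Open Scope ring_scope.

(* A Hilbert space is taken over the reals or over the complex numbers; the
   kind [k] says which.  In both cases the norm is [scalar R k]-valued, and an
   inequality [z <= w] between complex scalars means, as usual in MathComp, that
   [w - z] is real and nonnegative. *)
Variant scalar_kind := RealScalars | ComplexScalars.

Definition scalar (R : realType) (k : scalar_kind) : numFieldType :=
  match k with
  | RealScalars => R : numFieldType
  | ComplexScalars => R[i] : numFieldType
  end.

Definition sreal (R : realType) (k : scalar_kind) : R -> scalar R k :=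
  match k with
  | RealScalars => fun r => r
  | ComplexScalars => fun r => r%:C%C
  end.

Definition smk (R : realType) (k : scalar_kind) : R -> R -> scalar R k :=
  match k with
  | RealScalars => fun a _ => a
  | ComplexScalars => fun a b => (a +i* b)%C
  end.

Definition sRe (R : realType) (k : scalar_kind) : scalar R k -> R :=
  match k with
  | RealScalars => fun z => z
  | ComplexScalars => fun z => complex.Re z
  end.

Definition sIm (R : realType) (k : scalar_kind) : scalar R k -> R :=
  match k with
  | RealScalars => fun _ => 0
  | ComplexScalars => fun z => complex.Im z
  end.

Definition sconj (R : realType) (k : scalar_kind) : scalar R k -> scalar R k :=
  match k with
  | RealScalars => fun z => z
  | ComplexScalars => fun z => z^*%C
  end.

(* The inner product is linear in its first argument. *)
HB.mixin Record NormedModule_isPreHilbert (R : realType) (k : scalar_kind) H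
    & NormedModule (scalar R k) H := {
  inner : {dot H for @sconj R k};
  inner_norm : forall u : H, inner u u = `|u| ^+ 2
}.

#[short(type="preHilbertType")]
HB.structure Definition PreHilbert (R : realType) (k : scalar_kind) :=
  {H of NormedModule (scalar R k) H & NormedModule_isPreHilbert R k H}.

#[short(type="hilbertType")]
HB.structure Definition Hilbert (R : realType) (k : scalar_kind) :=
  {H of CompleteNormedModule (scalar R k) H & PreHilbert R k H}.


Record closed_subspace (R : realType) (k : scalar_kind) (H : hilbertType R k) := ClosedSubspace {
  subspace_set :> set H;
  subspace_closed : closed subspace_set;
  subspace0 : subspace_set 0;
  subspaceP : forall (a : scalar R k) (u v : H),
    subspace_set u -> subspace_set v -> subspace_set (a *: u + v)
}.

(* A closed subspace, with the inner product inherited from [H], is itself a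
   Hilbert space; [subspace_sort M] is that space and [incl] its inclusion. *)
Section SubspaceHilbert.
Context (R : realType) (k : scalar_kind) (H : hilbertType R k).
Variable M : closed_subspace H.

Definition in_subspace : pred H := fun u => u \in (M : set H).

Record subspace_sort := SubspaceElt {
  incl :> H;
  incl_in : in_subspace incl
}.

HB.instance Definition _ := [isSub for incl].
HB.instance Definition _ := [Choice of subspace_sort by <:].

Lemma in_subspace_submod : submod_closed in_subspace.
Proof.
split=> [|a u v]; first by apply/mem_set; exact: subspace0.
by move=> /set_mem Mu /set_mem Mv; apply/mem_set/subspaceP.
Qed.

HB.instance Definition _ :=
  GRing.isSubmodClosed.Build _ H in_subspace in_subspace_submod.
HB.instance Definition _ := [SubChoice_isSubLmodule of subspace_sort by <:].

Definition subspace_norm (u : subspace_sort) : scalar R k := `|incl u|.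

Lemma subspace_normD u v :
  subspace_norm (u + v) <= subspace_norm u + subspace_norm v.
Proof. exact: ler_normD. Qed.

Lemma subspace_normZ (a : scalar R k) u :
  subspace_norm (a *: u) = `|a| * subspace_norm u.
Proof. exact: normrZ. Qed.

Lemma subspace_norm0 u : subspace_norm u = 0 -> u = 0.
Proof. by move=> /normr0_eq0 u0; apply: val_inj. Qed.

HB.instance Definition _ := Lmodule_isNormed.Build (scalar R k) subspace_sort
  subspace_normD subspace_normZ subspace_norm0.

Lemma subspace_complete (F : set_system subspace_sort) :
  ProperFilter F -> cauchy F -> cvg F.
Proof.
move=> FF Fc.
have FG : ProperFilter (incl @ F) by exact: fmap_proper_filter.
have FG' : Filter (incl @ F) by typeclasses eauto.
have FF' : Filter F by typeclasses eauto.
have Gc : cauchy (incl @ F).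
  apply/(@cauchy_ballP (scalar R k) H) => e e0.
  case: (proj2 (@cauchy_ballP (scalar R k) _ F FF') Fc e e0) => -[A B] /= [FA FB] ABe.
  exists (incl @` A, incl @` B) => /=.
    by split; [apply: filterS FA | apply: filterS FB] => u Au; exists u.
  move=> [_ _] [/= [u Au <-] [v Bv <-]].
  have := ABe (u, v) (conj Au Bv).
  by rewrite -!ball_normE.
have [l Gcv] : exists l : H, incl u @[u --> F] --> l.
  by apply/cvg_ex; exact: cauchy_cvg (incl @ F) _ Gc.
have Gl := proj1 (@cvgrPdist_lt (scalar R k) H _ _ _ incl l) Gcv.
have Ml : l \in (M : set H).
  apply/mem_set/(@subspace_closed _ _ _ M) => B /nbhs_ballP[e /= e0 eB].
  near F => u.
  exists (incl u); split; first exact/set_mem/incl_in.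
  by apply: eB; rewrite -ball_normE /=; near: u; exact: Gl.
apply/cvg_ex; exists (SubspaceElt Ml).
by apply: (proj2 (@cvgrPdist_lt (scalar R k) _ _ F _ id _)) => e /Gl.
Unshelve. all: by end_near. Qed.

HB.instance Definition _ := Uniform_isComplete.Build subspace_sort subspace_complete.

Definition subspace_inner (u v : subspace_sort) : scalar R k :=
  inner (incl u) (incl v).

Lemma subspace_innerBl v : zmod_morphism (subspace_inner^~ v).
Proof. by move=> u w; exact: linearBl. Qed.

Lemma subspace_innerBr u : zmod_morphism (subspace_inner u).
Proof. by move=> v w; exact: linearBr. Qed.

Lemma subspace_innerZl v : scalable_for *%R (subspace_inner^~ v).
Proof. by move=> a u; exact: linearZl_LR. Qed.

Lemma subspace_innerZr u :
  scalable_for (@sconj R k \; *%R) (subspace_inner u).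
Proof. by move=> a v; exact: linearZr_LR. Qed.

HB.instance Definition _ := isBilinear.Build _ _ _ _ _ _ subspace_inner
  subspace_innerBl subspace_innerBr subspace_innerZl subspace_innerZr.

Lemma subspace_inner_herm u v :
  subspace_inner u v = (-1) ^+ false * sconj (subspace_inner v u).
Proof. exact: (hermitian_subproof (s := inner)). Qed.

HB.instance Definition _ := isHermitianSesquilinear.Build _ _ false (@sconj R k)
  subspace_inner subspace_inner_herm.

Lemma subspace_inner_gt0 u : u != 0 -> 0 < subspace_inner u u.
Proof. by move=> u0; apply: neq0_dnorm_gt0; rewrite (inj_eq val_inj _ 0). Qed.

HB.instance Definition _ :=
  isDotProduct.Build _ _ subspace_inner subspace_inner_gt0.

Lemma subspace_inner_norm u :
  (subspace_inner : {dot subspace_sort for @sconj R k}) u u = `|u| ^+ 2.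
Proof. exact: inner_norm. Qed.

HB.instance Definition _ :=
  NormedModule_isPreHilbert.Build R k subspace_sort subspace_inner_norm.

End SubspaceHilbert.

Definition separable (T : topologicalType) :=
  exists2 D : set T, countable D & dense D.

Section Operators.
Context (R : realType) (k : scalar_kind).

Definition bounded_linear (V W : hilbertType R k) (L : {linear V -> W}) :=
  exists C : R, forall u : V, `|L u| <= sreal k C * `|u|.

(* The adjoint of a bounded [L] exists and is unique, so the default value of
   [xget] is then not used. *)
Definition adjoint (V W : hilbertType R k) (L : {linear V -> W}) (w : W) : V :=
  xget 0 [set a | forall u : V, inner (L u) w = inner u a].

(* As for [adjoint], the element selected by [xget] exists and is unique. *)
Definition orth_proj (H : hilbertType R k) (M : closed_subspace H) (f : H) :
    subspace_sort M :=
  xget 0 [set m | forall m' : subspace_sort M,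
                    inner (f - incl m : H) (incl m' : H) = 0].

Definition positive_op (H : hilbertType R k) (S : {linear H -> H}) :=
  adjoint S =1 S /\ forall f : H, 0 <= inner (S f) f.

Definition GBplus (H : hilbertType R k) (S : {linear H -> H}) :=
  [/\ bounded_linear S, positive_op S
    & exists S' : {linear H -> H},
        [/\ bounded_linear S', cancel S S' & cancel S' S]].

(* P_M L^* L P_M *)
Definition gfusion_op (H K : hilbertType R k) (M : closed_subspace H)
    (L : {linear subspace_sort M -> K}) (h : H) : H :=
  incl (orth_proj M (incl (adjoint L (L (orth_proj M h))))).

End Operators.

Section ScalarIntegral.
Context (R : realType) (k : scalar_kind) (d : measure_display)
  (X : measurableType d).

Definition smeasurable (g : X -> scalar R k) :=
  measurable_fun setT (fun x => sRe (g x)) /\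
  measurable_fun setT (fun x => sIm (g x)).

Definition sintegrable (mu : {measure set X -> \bar R}) (g : X -> scalar R k) :=
  mu.-integrable setT (fun x => (sRe (g x))%:E) /\
  mu.-integrable setT (fun x => (sIm (g x))%:E).

Definition sintegral (mu : {measure set X -> \bar R}) (g : X -> scalar R k) :
    scalar R k :=
  smk k (\int[mu]_x sRe (g x)) (\int[mu]_x sIm (g x)).

End ScalarIntegral.

Section Frames.
Context (R : realType) (k : scalar_kind) (d : measure_display)
  (X : measurableType d) (H : hilbertType R k).

(* H carries its Borel sigma-algebra. *)
Definition weakly_measurable (F : X -> closed_subspace H) :=
  forall f : H, measurable_fun setT
    (fun x => incl (orth_proj (F x) f) : g_sigma_algebraType (@open H)).

Variables (F : X -> closed_subspace H) (K : X -> hilbertType R k)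
  (L : forall x, {linear subspace_sort (F x) -> K x}) (v : X -> R)
  (T U : {linear H -> H}).

Definition frame_integrand (f : H) (x : X) : scalar R k :=
  sreal k (v x ^+ 2) *
  inner (L x (orth_proj (F x) (U f))) (L x (orth_proj (F x) (T f))).

(* Two-sided bounds on an integral presuppose that it converges, hence the
   integrability clause. *)
Definition controlled_gfusion_frame_bounds (mu : {measure set X -> \bar R})
    (A B : R) :=
  [/\ 0 < A, A <= B,
      forall f : H, sintegrable mu (frame_integrand f)
    & forall f : H,
        sreal k A * `|f| ^+ 2 <= sintegral mu (frame_integrand f)
          <= sreal k B * `|f| ^+ 2].

Definition controlled_gfusion_frame (mu : {measure set X -> \bar R}) :=
  exists A B : R, controlled_gfusion_frame_bounds mu A B.

End Frames.

(* Main.v *)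
Require Import Defs.
From HB Require Import structures.
From mathcomp Require Import all_boot all_order all_algebra complex.
From mathcomp Require Import all_classical all_reals all_analysis.
From mathcomp Require Import measurable_realfun ring lra.

Set Implicit Arguments.
Unset Strict Implicit.
Unset Printing Implicit Defensive.

Import Order.TTheory GRing.Theory Num.Theory.
Import numFieldNormedType.Exports.

Local Open Scope classical_set_scope.
Local Open Scope ring_scope.

(** Write [a x] and [g x] for the scalars
    [< Lambda_x P_F U f, Lambda_x P_F T f >] and
    [< Gamma_x P_G U f, Gamma_x P_G T f >].  Once adjoints and projections are
    known to have their defining properties ([adjointP], [orth_projP]), moving
    [T^*], [Gamma_x^*] and the projections across the inner product turns the
    hypothesis into a pointwise statement about these two scalars:
    [0 <= g - a <= lambda1 a + lambda2 g + eta |f|^2].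
    Hence [g] and [a] have the same imaginary part, and, for real parts,
    [a <= g <= ((1 + lambda1) a + eta |f|^2) / (1 - lambda2)]
    ([perturbation_bounds]).  Multiplying by [v^2] and integrating, the lower
    frame bound [A] is inherited, and the upper bound becomes
    [((1 + lambda1) B + D) / (1 - lambda2)] with
    [D] the integral of [max(eta, 0) v^2].  The positivity of
    [A (1 - lambda1) - eta \int v^2] makes [D] finite: it forbids
    [\int v^2 = +oo] when [eta > 0], while for [eta <= 0] the term in [eta] can
    be dropped ([weight_integrable]).  The same two-sided bound gives the
    integrability of [v^2 g] ([sandwich_integrable]).

    Both adjoints and orthogonal projections come from a single fact, the Riesz
    representation of bounded functionals: the projection onto [M] is the
    adjoint of the inclusion of [M].  To treat real and complex scalars at once,
    the representation is proved for real-linear functionals and the real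
    bilinear form [Re <u, v>] ([riesz_real]), where it amounts to minimising
    [|u|^2 - 2 l(u)]: near-minimisers form a Cauchy filter by the parallelogram
    identity, and stationarity at its limit is the representation. *)

(** * Real and complex scalars *)

Section Scalars.
Context (R : realType) (k : scalar_kind).
Implicit Types (z w : Defs.scalar R k) (r : R).

Lemma sReD z w : sRe (z + w) = sRe z + sRe w.
Proof. by case: k z w => [|] // [a b] [c e]. Qed.

Lemma sReN z : sRe (- z) = - sRe z.
Proof. by case: k z => [|] // [a b]. Qed.

Lemma sReB z w : sRe (z - w) = sRe z - sRe w.
Proof. by rewrite sReD sReN. Qed.

Lemma sImD z w : sIm (z + w) = sIm z + sIm w.
Proof. by case: k z w => [z w|[a b] [c e]] //=; rewrite addr0. Qed.

Lemma sImN z : sIm (- z) = - sIm z.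
Proof. by case: k z => [z|[a b]] //=; rewrite oppr0. Qed.

Lemma sImB z w : sIm (z - w) = sIm z - sIm w.
Proof. by rewrite sImD sImN. Qed.

Lemma sRe_conj z : sRe (sconj z) = sRe z.
Proof. by case: k z => [|] // [a b]. Qed.

Lemma sRe_realM r z : sRe (sreal k r * z) = r * sRe z.
Proof. by case: k z => [|] // [a b] /=; rewrite mul0r subr0. Qed.

Lemma sIm_realM r z : sIm (sreal k r * z) = r * sIm z.
Proof. by case: k z => [z|[a b]] /=; rewrite ?mulr0 // mul0r addr0. Qed.

Lemma sRe_real r : sRe (sreal k r) = r. Proof. by case: k. Qed.

Lemma sIm_real r : sIm (sreal k r) = 0. Proof. by case: k. Qed.

Lemma scalar_eq z w : sRe z = sRe w -> sIm z = sIm w -> z = w.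
Proof. by case: k z w => [|] // [a b] [c e] /= -> ->. Qed.

Lemma slerE z w : (z <= w) = (sIm w == sIm z) && (sRe z <= sRe w).
Proof. by case: k z w => [|] z w /=; rewrite ?eqxx // lecE. Qed.

Lemma sreal_ge0 r : (0 <= sreal k r) = (0 <= r).
Proof. by case: k => [|] //=; rewrite lecE /= eqxx. Qed.

Lemma sreal_gt0 r : (0 < sreal k r) = (0 < r).
Proof. by case: k => [|] //=; rewrite ltcE /= eqxx. Qed.

Lemma sReK z : 0 <= z -> sreal k (sRe z) = z.
Proof.
rewrite slerE => /andP[/eqP z0 _]; apply: scalar_eq; first by rewrite sRe_real.
by rewrite sIm_real z0; case: k.
Qed.

(** Since [Re (conj z * z) = |z|^2], a linear functional is recovered from its
    real part by rescaling its argument by [conj z]. *)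
Lemma sRe_mul_conj_eq0 z : sRe (sconj z * z) = 0 -> z = 0.
Proof.
case: k z => [|] z /=.
  by move=> /eqP; rewrite mulf_eq0 orbb => /eqP.
case: z => a b /= h; have {}h : a ^+ 2 + b ^+ 2 = 0 by rewrite -h; ring.
by move: h => /eqP; rewrite paddr_eq0 ?sqr_ge0 // !sqrf_eq0 => /andP[/eqP-> /eqP->].
Qed.

End Scalars.

(** * The real inner product *)

(** The constant [c] may vanish, in which case the quadratic is affine and [b]
    must vanish too.  It yields both the Cauchy-Schwarz inequality and the
    near-stationarity of near-minimisers. *)
Lemma discriminant (R : realFieldType) (a b c : R) : 0 <= c ->
  (forall t : R, 0 <= a + 2 * t * b + t ^+ 2 * c) -> b ^+ 2 <= a * c.
Proof.
rewrite le_eqVlt => /predU1P[<-|c0] h; last first.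
  have := h (- (b / c)); rewrite -(pmulr_lge0 _ c0).
  have -> : (a + 2 * - (b / c) * b + (- (b / c)) ^+ 2 * c) * c = a * c - b ^+ 2.
    by field; rewrite gt_eqF.
  by rewrite subr_ge0.
have [->|b0] := eqVneq b 0; first by rewrite expr0n mulr0.
(* The affine function [a + 2 t b] takes the value [-1] at this [t]. *)
have := h (- ((a + 1) / (2 * b))).
have -> : a + 2 * - ((a + 1) / (2 * b)) * b +
  (- ((a + 1) / (2 * b))) ^+ 2 * 0 = - 1 by field.
by rewrite ler0N1.
Qed.

Section RealInner.
Context (R : realType) (k : scalar_kind) (V : hilbertType R k).
Implicit Types (u v w : V) (t : R).

(** The real Hilbert space structure underlying [V]: over the complex scalars
    this is the restriction of scalars. *)
Definition rdot u v : R := sRe (inner u v).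
Definition rnorm u : R := sRe `|u|.
Definition rscale t u : V := sreal k t *: u.

Lemma innerC u v : inner u v = sconj (inner v u).
Proof. by rewrite (hermitian_subproof (s := inner)) expr0 mul1r. Qed.

Lemma innerBl u v w : inner (u - v) w = inner u w - inner v w.
Proof. exact: linearBl. Qed.

Lemma rdotC u v : rdot u v = rdot v u.
Proof. by rewrite /rdot innerC sRe_conj. Qed.

Lemma rdotDl u v w : rdot (u + v) w = rdot u w + rdot v w.
Proof. by rewrite /rdot linearDl sReD. Qed.

Lemma rdotZl t u w : rdot (rscale t u) w = t * rdot u w.
Proof. by rewrite /rdot linearZl_LR sRe_realM. Qed.

Lemma rdotDr u v w : rdot w (u + v) = rdot w u + rdot w v.
Proof. by rewrite !(rdotC w) rdotDl. Qed.

Lemma rdotZr t u w : rdot w (rscale t u) = t * rdot w u.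
Proof. by rewrite !(rdotC w) rdotZl. Qed.

Lemma rdotNl u w : rdot (- u) w = - rdot u w.
Proof. by rewrite /rdot linearNl sReN. Qed.

Lemma rdotNr u w : rdot w (- u) = - rdot w u.
Proof. by rewrite !(rdotC w) rdotNl. Qed.

Lemma normE u : `|u| = sreal k (rnorm u).
Proof. by rewrite sReK. Qed.

Lemma norm_lt u (e : Defs.scalar R k) : 0 < e -> (`|u| < e) = (rnorm u < sRe e).
Proof.
move=> e0; rewrite real_ltNge ?normr_real ?gtr0_real // slerE ltNge.
have -> : sIm e = 0.
  by move: (ltW e0); rewrite slerE => /andP[/eqP -> _]; case: (k).
by rewrite normE sIm_real eqxx sRe_real.
Qed.

Lemma rnorm_ge0 u : 0 <= rnorm u.
Proof. by rewrite -(sreal_ge0 k) -normE. Qed.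

Lemma rdotE u : rdot u u = rnorm u ^+ 2.
Proof. by rewrite /rdot inner_norm expr2 {1}normE sRe_realM. Qed.

Lemma rdot_ge0 u : 0 <= rdot u u.
Proof. by rewrite rdotE sqr_ge0. Qed.

Lemma rdot_cauchy u v : `|rdot u v| <= rnorm u * rnorm v.
Proof.
rewrite -ler_sqr ?nnegrE ?mulr_ge0 ?rnorm_ge0 // real_normK ?num_real //.
rewrite exprMn -!rdotE; apply: discriminant => [|t]; first exact: rdot_ge0.
have := rdot_ge0 (u + rscale t v).
rewrite !(rdotDl, rdotDr, rdotZl, rdotZr) (rdotC v u).
by congr (0 <= _); ring.
Qed.

End RealInner.

(** * Riesz representation and adjoints *)

Section Riesz.
Context (R : realType) (k : scalar_kind) (V : hilbertType R k).
Implicit Types (u v w : V) (t : R).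

(** Minimise [J u = |u|^2 - 2 l u], which is at least [- C^2].  The filter of
    near-minimisers replaces a minimising sequence, so no choice of points is
    made, and [J] need not be evaluated at the limit: an [e]-near-minimiser [u]
    already satisfies [(<u, w> - l w)^2 <= e |w|^2]. *)
Lemma riesz_real (l : V -> R) (C : R) :
  (forall u v, l (u + v) = l u + l v) ->
  (forall t u, l (rscale t u) = t * l u) ->
  (forall u, `|l u| <= C * rnorm u) ->
  exists a, forall u, l u = rdot u a.
Proof.
move=> lD lZ lC.
pose J u := rdot u u - 2 * l u.
have J_ge u : - C ^+ 2 <= J u.
  rewrite /J rdotE; have := sqr_ge0 (rnorm u - C); have := lC u.
  by have := ler_norm (l u); nra.
have Jinf : has_inf (range J).
  split; first by exists (J 0); exists 0.
  by exists (- C ^+ 2) => _ [u _ <-].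
pose m := inf (range J).
have m_le u : m <= J u by apply: ge_inf; [exact: Jinf.2 | exists u].
pose E e := [set u | J u < m + e].
have E_ex e : 0 < e -> exists u, E e u.
  by move=> e0; have [_ [u _ <-] ?] := inf_adherent e0 Jinf; exists u.
(* Parallelogram identity: [|u - v|^2 = 2 J u + 2 J v - 4 J ((u + v) / 2)]. *)
have E_diam e u v : E e u -> E e v -> rnorm (u - v) ^+ 2 < 4 * e.
  rewrite /E /= => Eu Ev; have := m_le (rscale 2^-1 (u + v)).
  move: Eu Ev; rewrite /J -rdotE lZ lD.
  rewrite !(rdotDl, rdotDr, rdotZl, rdotZr, rdotNl, rdotNr) (rdotC v u).
  lra.
pose F := filter_from [set e : R | 0 < e] E.
have FF : ProperFilter F.
  apply: filter_from_proper => //; apply: filter_from_filter.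
    by exists 1 => /=.
  move=> e1 e2 /= e10 e20; exists (Order.min e1 e2) => /=.
    by rewrite lt_min e10.
  move=> u; rewrite /E /= => h; split; apply: lt_le_trans h _;
    by rewrite lerD2l ge_min lexx ?orbT.
have Fc : cauchy F.
  apply/(@cauchy_ballP (Defs.scalar R k) V) => e e0.
  have e0' : 0 < sRe e.
    have := norm_lt (0 : V) e0; rewrite normr0 e0 => /esym.
    by apply: le_lt_trans; exact: rnorm_ge0.
  pose s := sRe e ^+ 2 / 4.
  have s0 : 0 < s by rewrite divr_gt0 // exprn_gt0.
  exists (E s, E s); first by split; exists s.
  move=> [u v] [/= Eu Ev]; rewrite -ball_normE /= norm_lt //.
  rewrite -ltr_sqr ?nnegrE ?rnorm_ge0 ?ltW //.
  by have := E_diam _ _ _ Eu Ev; rewrite /s mulrC divfK.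
have [a Fa] : exists a : V, F --> a by apply/cvg_ex; exact: cauchy_cvg.
exists a => w; apply/eqP; rewrite -subr_eq0 -normr_eq0; apply: contraT => x0.
set x := l w - rdot w a in x0 *.
have {}x0 : 0 < `|x| by rewrite lt_def x0 normr_ge0.
(* This [e] satisfies [e K < |x|], which contradicts the estimate
   [|x| <= e K] obtained from near-minimisers close to [a]. *)
pose K := 2 * rnorm w; have K0 : 0 <= K by rewrite mulr_ge0 ?rnorm_ge0.
pose e := `|x| / (K + 1).
have e0 : 0 < e by rewrite divr_gt0 ?ltr_wpDl.
have es0 : 0 < sreal k e by rewrite sreal_gt0.
(* The slack [e^2] makes the stationarity defect at [u] at most [e |w|]. *)
have [u [au Eu]] : ball a (sreal k e) `&` E (e ^+ 2) !=set0.
  apply: (@filter_ex _ F FF); apply: filterI; first exact: Fa (nbhsx_ballx a _ es0).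
  by exists (e ^+ 2); rewrite //= exprn_gt0.
move: au; rewrite -ball_normE /= norm_lt // sRe_real => au.
have uw : `|rdot u w - l w| <= e * rnorm w.
  have ew : 0 <= e * rnorm w by rewrite mulr_ge0 ?rnorm_ge0 // ltW.
  rewrite -ler_sqr ?nnegrE // real_normK ?num_real //.
  rewrite exprMn -rdotE; apply: discriminant => [|t]; first exact: rdot_ge0.
  have := m_le (u + rscale t w); move: Eu; rewrite /E /J /= lD lZ.
  rewrite !(rdotDl, rdotDr, rdotZl, rdotZr) (rdotC w u); nra.
have aw : `|rdot (a - u) w| <= e * rnorm w.
  by apply: (le_trans (rdot_cauchy _ _)); rewrite ler_wpM2r ?rnorm_ge0 // ltW.
have : `|x| <= e * K.
  rewrite /x (rdotC w a) -normrN opprB.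
  have -> : rdot a w - l w = rdot (a - u) w + (rdot u w - l w).
    by rewrite rdotDl rdotNl; ring.
  by apply: (le_trans (ler_normD _ _)); apply: (le_trans (lerD aw uw)); rewrite /K; lra.
by rewrite /e mulrAC ler_pdivlMr ?ltr_wpDl // ler_pM2l // gerDl ler10.
Qed.

Lemma bounded_rdot (W : hilbertType R k) (L : {linear V -> W}) (w : W) :
  bounded_linear L -> exists C, forall u, `|rdot (L u) w| <= C * rnorm u.
Proof.
move=> [C LC]; exists (C * rnorm w) => u.
apply: (le_trans (rdot_cauchy _ _)); rewrite mulrAC ler_wpM2r ?rnorm_ge0 //.
by have := LC u; rewrite slerE !normE sRe_realM !sRe_real => /andP[].
Qed.

(** The Riesz vector is found for the real part of [<L u, w>]; the difference
    [z] of the two sides then has zero real part at every [u], in particular at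
    [conj z *: u], where it equals [|z|^2]. *)
Lemma adjointP (W : hilbertType R k) (L : {linear V -> W}) :
  bounded_linear L -> forall (w : W) u, inner (L u) w = inner u (adjoint L w).
Proof.
move=> Lb w.
suff : exists a, forall u, inner (L u) w = inner u a.
  by move=> [a aP]; rewrite /adjoint; case: xgetP => [b _ //|/(_ a)].
have [C LC] := bounded_rdot w Lb.
have [a aP] : exists a, forall u, rdot (L u) w = rdot u a.
  apply: riesz_real LC => [u v|t u]; first by rewrite linearD rdotDl.
  by rewrite -rdotZl /rscale linearZ.
exists a => u; apply/eqP; rewrite -subr_eq0; apply/eqP/sRe_mul_conj_eq0.
rewrite mulrBr -!linearZl_LR -linearZ sReB; apply/eqP; rewrite subr_eq0; apply/eqP.
exact: aP.
Qed.

End Riesz.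

(** * Projections and fusion operators *)

Section Projection.
Context (R : realType) (k : scalar_kind) (H : hilbertType R k).
Implicit Types (M : closed_subspace H) (f g h : H).

Lemma incl_bounded M : bounded_linear (val : {linear subspace_sort M -> H}).
Proof.
exists 1 => u; suff -> : sreal k 1 * `|u| = `|u| by [].
by apply: scalar_eq; rewrite ?sRe_realM ?sIm_realM mul1r.
Qed.

(** The adjoint of the inclusion of [M] supplies a witness, so the default of
    [xget] is not reached. *)
Lemma orth_projP M f (m : subspace_sort M) :
  inner f (Defs.incl m) = inner (Defs.incl (orth_proj M f)) (Defs.incl m).
Proof.
suff : exists p : subspace_sort M, forall m' : subspace_sort M,
    inner (f - Defs.incl p : H) (Defs.incl m' : H) = 0.
  move=> [p pP]; rewrite /orth_proj; case: xgetP => [q _ qP|/(_ p) //].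
  by apply/eqP; rewrite -subr_eq0 -innerBl; apply/eqP; exact: qP.
exists (adjoint (val : {linear subspace_sort M -> H}) f) => m'.
have adjE := adjointP (@incl_bounded M) f m'.
by rewrite innerBl /= innerC adjE -innerC subrr.
Qed.

Lemma orth_proj_id M (m : subspace_sort M) : orth_proj M (Defs.incl m) = m.
Proof.
apply/eqP; rewrite -subr_eq0; set r := _ - m.
rewrite -normr_eq0 -sqrf_eq0 -inner_norm.
have rE : Defs.incl r = Defs.incl (orth_proj M (Defs.incl m)) - Defs.incl m by [].
rewrite -[inner _ _]/(inner (Defs.incl r) (Defs.incl r)) {1}rE.
by rewrite innerBl (orth_projP (Defs.incl m) r) subrr.
Qed.

(** The outer projection acts on a vector of [M] and is moved onto [g]. *)
Lemma inner_gfusion_op (K : hilbertType R k) M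
    (L : {linear subspace_sort M -> K}) (h g : H) : bounded_linear L ->
  inner (gfusion_op L h) g = inner (L (orth_proj M h)) (L (orth_proj M g)).
Proof.
move=> Lb; rewrite /gfusion_op orth_proj_id innerC orth_projP -innerC.
set p := orth_proj M g; set q := L (orth_proj M h).
by rewrite innerC [RHS]innerC; congr sconj; rewrite (adjointP Lb q p).
Qed.

Lemma inner_adjointl (K : hilbertType R k) (T : {linear H -> K}) (y : K) (f : H) :
  bounded_linear T -> inner (adjoint T y) f = inner y (T f).
Proof. by move=> Tb; rewrite innerC -adjointP // -innerC. Qed.

End Projection.

(** * Norm bounds and integrals *)

Section NormBounds.
Context (R : realType) (k : scalar_kind) (H : hilbertType R k).
Implicit Types (f : H) (z : Defs.scalar R k).

Lemma norm_sqrE f : `|f| ^+ 2 = sreal k (rnorm f ^+ 2).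
Proof. by rewrite -inner_norm -rdotE sReK // inner_norm exprn_ge0. Qed.

Lemma ge_norm_sqr (a : R) f z :
  (sreal k a * `|f| ^+ 2 <= z) = (sIm z == 0) && (a * rnorm f ^+ 2 <= sRe z).
Proof. by rewrite slerE norm_sqrE sIm_realM sRe_realM sIm_real sRe_real mulr0. Qed.

Lemma le_norm_sqr (b : R) f z :
  (z <= sreal k b * `|f| ^+ 2) = (sIm z == 0) && (sRe z <= b * rnorm f ^+ 2).
Proof.
by rewrite slerE norm_sqrE sIm_realM sRe_realM sIm_real sRe_real mulr0 eq_sym.
Qed.

End NormBounds.

Section Integrals.
Context (R : realType) (d : measure_display) (X : measurableType d)
  (mu : {measure set X -> \bar R}).

Lemma sRe_sintegral k (g : X -> Defs.scalar R k) :
  sRe (Defs.sintegral mu g) = \int[mu]_x sRe (g x).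
Proof. by case: k g. Qed.

Lemma sIm_sintegral k (g : X -> Defs.scalar R k) :
  sIm (Defs.sintegral mu g) = \int[mu]_x sIm (g x).
Proof. by case: k g => g //=; rewrite /Rintegral integral0. Qed.

Lemma sandwich_integrable (l g u : X -> R) :
  mu.-integrable setT (EFin \o l) -> mu.-integrable setT (EFin \o u) ->
  measurable_fun setT g -> (forall x, l x <= g x <= u x) ->
  mu.-integrable setT (EFin \o g).
Proof.
move=> il iu mg lgu.
apply: (@le_integrable _ _ _ mu _ measurableT _ (fun x => `|l x|%:E + `|u x|%:E)%E).
- exact/measurable_EFinP.
- move=> x _ /=; rewrite lee_fin.
  have /andP[lg gu] := lgu x.
  rewrite [leRHS]ger0_norm ?addr_ge0 // ler_norml.
  have := ler_norm (- l x); have := ler_norm (u x); rewrite normrN.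
  have := normr_ge0 (l x); have := normr_ge0 (u x); lra.
- have h1 : mu.-integrable setT (fun x => `|(l x)%:E|%E) := integrable_abse il.
  have h2 : mu.-integrable setT (fun x => `|(u x)%:E|%E) := integrable_abse iu.
  exact: integrableD h1 h2.
Qed.

Lemma integrable_scale (c : R) (g : X -> R) :
  mu.-integrable setT (EFin \o g) -> mu.-integrable setT (EFin \o (fun x => c * g x)).
Proof. exact: integrableZl. Qed.

Lemma integrable_add (g h : X -> R) :
  mu.-integrable setT (EFin \o g) -> mu.-integrable setT (EFin \o h) ->
  mu.-integrable setT (EFin \o (fun x => g x + h x)).
Proof. by move=> ig ih; exact: integrableD ig ih. Qed.

(** When [eta > 0] and the integral of [v^2] is infinite, the quantity assumed
    positive is [-oo]. *)
Lemma weight_integrable (v : X -> R) (a eta : R) :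
  measurable_fun setT v ->
  (0 < a%:E - eta%:E * \int[mu]_x (v x ^+ 2)%:E)%E ->
  mu.-integrable setT (EFin \o (fun x => Num.max eta 0 * v x ^+ 2)).
Proof.
move=> mv; have [eta0 _|eta0 pos] := leP eta 0.
  by under eq_fun do rewrite mul0r; exact: integrable0.
apply: integrable_scale; apply/integrableP; split.
  by apply/measurable_EFinP; exact: measurable_funX.
under eq_integral do rewrite /= ger0_norm ?sqr_ge0 //.
rewrite ltey; apply: contraPN pos => /eqP ->.
by rewrite gt0_muley ?lte_fin // ltNge.
Qed.

End Integrals.

(** * Perturbation of frames *)

Section Perturbation.
Context (R : realType) (k : scalar_kind) (H : hilbertType R k).

(** An inequality between complex scalars says that their difference is real,
    so [g - a >= 0] forces equal imaginary parts although [a] and [g] need not be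
    real themselves. *)
Lemma perturbation_bounds (a g : Defs.scalar R k) (f : H) (l1 l2 eta : R) :
  0 <= g - a <= sreal k l1 * a + sreal k l2 * g + sreal k eta * `|f| ^+ 2 ->
  [/\ sIm g = sIm a, sRe a <= sRe g &
    (1 - l2) * sRe g <= (1 + l1) * sRe a + eta * rnorm f ^+ 2].
Proof.
rewrite norm_sqrE !slerE !sImB !sReB !sReD !sRe_realM sRe_real.
have -> : sIm (0 : Defs.scalar R k) = 0 by case: (k).
have -> : sRe (0 : Defs.scalar R k) = 0 by case: (k).
rewrite subr_eq0 subr_ge0 => /andP[/andP[/eqP ga ag] /andP[_ h]].
by split=> //; lra.
Qed.

End Perturbation.

Theorem theorem5p1 (R : realType) (k : scalar_kind)
  (H : hilbertType R k) (sepH : separable H)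
  (d : measure_display) (X : measurableType d) (mu : {measure set X -> \bar R})
  (T U : {linear H -> H}) (TGB : GBplus T) (UGB : GBplus U)
  (F G : X -> closed_subspace H)
  (Fmeas : weakly_measurable F) (Gmeas : weakly_measurable G)
  (v : X -> R) (vmeas : measurable_fun setT v) (v_ge0 : forall x, 0 <= v x)
  (K : X -> hilbertType R k)
  (Lambda : forall x, {linear subspace_sort (F x) -> K x})
  (Gamma : forall x, {linear subspace_sort (G x) -> K x})
  (Lambda_bounded : forall x, bounded_linear (Lambda x))
  (Gamma_bounded : forall x, bounded_linear (Gamma x))
  (Lambda_meas : forall f : H, smeasurable (frame_integrand Lambda v T U f))
  (Gamma_meas : forall f : H, smeasurable (frame_integrand Gamma v T U f))
  (A B : R)
  (Lambda_frame : controlled_gfusion_frame_bounds Lambda v T U mu A B)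
  (lambda1 lambda2 eta : R)
  (lambda1_bound : 0 <= lambda1 < 1) (lambda2_bound : 0 <= lambda2 < 1)
  (A_eta : (0 < (A * (1 - lambda1))%:E - eta%:E * \int[mu]_x (v x ^+ 2)%:E)%E)
  (perturb : forall (f : H) (x : X),
    0 <= inner (adjoint T (gfusion_op (Gamma x) (U f)
                           - gfusion_op (Lambda x) (U f))) f
      <= sreal k lambda1 * inner (adjoint T (gfusion_op (Lambda x) (U f))) f
         + sreal k lambda2 * inner (adjoint T (gfusion_op (Gamma x) (U f))) f
         + sreal k eta * `|f| ^+ 2) :
  controlled_gfusion_frame Gamma v T U mu.
Proof.
have [Tb _ _] := TGB; have [A0 AB Lint Lbd] := Lambda_frame.
have /andP[l10 _] := lambda1_bound; have /andP[l20 l21] := lambda2_bound.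
(* Replacing [eta] by its positive part keeps the upper bound valid and makes
   the weight [w] integrable whatever the sign of [eta]. *)
pose c := Num.max eta 0; pose w x := c * v x ^+ 2.
have wint : mu.-integrable setT (EFin \o w) := weight_integrable vmeas A_eta.
pose D := \int[mu]_x w x.
have D0 : 0 <= D.
  by apply: Rintegral_ge0 => x _; rewrite mulr_ge0 ?sqr_ge0 // le_max lexx orbT.
have q0 : 0 < 1 - lambda2 by rewrite subr_gt0.
pose p f x := sRe (frame_integrand Lambda v T U f x).
pose r f x := sRe (frame_integrand Gamma v T U f x).
pose u f x := (1 - lambda2)^-1 * ((1 + lambda1) * p f x + rnorm f ^+ 2 * w x).
have pointwise f x : [/\ sIm (frame_integrand Gamma v T U f x) =
    sIm (frame_integrand Lambda v T U f x), p f x <= r f x & r f x <= u f x].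
  have := perturb f x; rewrite !inner_adjointl // innerBl !inner_gfusion_op //.
  move=> /perturbation_bounds[im lo hi].
  have v2 := sqr_ge0 (v x).
  split; first by rewrite !sIm_realM im.
    by rewrite /p /r !sRe_realM; exact: ler_wpM2l.
  rewrite ler_pdivlMl // /p /r !sRe_realM /w mulrCA (mulrCA (1 + lambda1)).
  have etac : eta * rnorm f ^+ 2 <= c * rnorm f ^+ 2.
    by rewrite ler_wpM2r ?sqr_ge0 // le_max lexx.
  have := ler_wpM2l v2 (le_trans hi (lerD (lexx _) etac)).
  by rewrite mulrDr; congr (_ <= _ + _); ring.
have pint f : mu.-integrable setT (EFin \o p f) by have [] := Lint f.
have pint1 f := integrable_scale (1 + lambda1) (pint f).
have wint1 (f : H) := integrable_scale (rnorm f ^+ 2) wint.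
have uint0 f := integrable_add (pint1 f) (wint1 f).
have uint f : mu.-integrable setT (EFin \o u f) := integrable_scale _ (uint0 f).
have rint f : mu.-integrable setT (EFin \o r f).
  apply: sandwich_integrable (pint f) (uint f) (Gamma_meas f).1 _ => x.
  by have [_ -> ->] := pointwise f x.
have uE f : \int[mu]_x u f x =
    (1 - lambda2)^-1 * ((1 + lambda1) * \int[mu]_x p f x + rnorm f ^+ 2 * D).
  rewrite (RintegralZl _ measurableT (uint0 f)).
  rewrite (RintegralD measurableT (pint1 f) (wint1 f)).
  by rewrite (RintegralZl _ measurableT (pint f)) (RintegralZl _ measurableT wint).
exists A, (((1 + lambda1) * B + D) / (1 - lambda2)).
split=> //.
- rewrite ler_pdivlMr //.
  have := mulr_ge0 (ltW A0) l20.
  have := mulr_ge0 (le_trans (ltW A0) AB) l10.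
  nra.
- move=> f; split; first exact: rint.
  under eq_fun do rewrite (let: And3 e _ _ := pointwise f _ in e).
  by have [] := Lint f.
(* The imaginary part of the integral vanishes because it is the one of the
   integral for [Lambda], which lies between two real numbers. *)
- move=> f; rewrite ge_norm_sqr le_norm_sqr sRe_sintegral sIm_sintegral.
  have -> : \int[mu]_x sIm (frame_integrand Gamma v T U f x) = 0.
    have := Lbd f; rewrite ge_norm_sqr sIm_sintegral => /andP[/andP[/eqP e _] _].
    by rewrite -e; apply: eq_Rintegral => x _; have [] := pointwise f x.
  have := Lbd f; rewrite ge_norm_sqr le_norm_sqr sRe_sintegral eqxx /=.
  move=> /andP[/andP[_ lo] /andP[_ hi]]; apply/andP; split.
    by apply: (le_trans lo); apply: (le_Rintegral measurableT (pint f) (rint f)) => x _;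
      have [] := pointwise f x.
  have : \int[mu]_x r f x <= \int[mu]_x u f x.
    by apply: (le_Rintegral measurableT (rint f) (uint f)) => x _;
      have [] := pointwise f x.
  move=> /le_trans; apply; rewrite uE [leRHS]mulrAC [leRHS]mulrC ler_pM2l ?invr_gt0 //.
  rewrite [leRHS]mulrDl (mulrC D) lerD2r -[leRHS]mulrA.
  by rewrite ler_wpM2l // addr_ge0.
Qed.
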